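(* Fix $d$ and a constant $c$. There is a constant $C$ (depending only on $d$ and $c$) such that every connected graph $G$ of order $n$ with minimum degree $d$ and $|\mathrm{diam}(G)-\frac{3n}{d+1}|\le c$ belongs to the family $\mathscr{F}_{n,d,C}$.
   Context: The sequential join $G_1+\cdots+G_k$ of vertex-disjoint graphs is obtained from their union by joining every vertex of $G_i$ to every vertex of $G_{i+1}$, $i=1,\ldots,k-1$. $\mathcal{G}(a,b,c;m)$ denotes the sequential join of the $3m$ complete graphs $K_a,K_b,K_c,K_a,K_b,K_c,\ldots,K_a,K_b,K_c$; these cliques are called its cells. Given positive integers $n,d$ and a constant $C$, a graph $\mathcal{G}$ belongs to $\mathscr{F}_{n,d,C}$ if (i) there exist positive integers $t\le C$, $m_1,\ldots,m_t$, $a_1,b_1,c_1,\ldots,a_t,b_t,c_t$ with $a_i+b_i+c_i=d+1$, and graphs $H_0,\ldots,H_t$ with $\sum_{i=0}^t|V(H_i)|\le C$ and $\sum_{i=1}^t m_i(d+1)+\sum_{i=0}^t|V(H_i)|=n$; and (ii) $\mathcal{G}$ is connected and is obtained from the disjoint union $H_0\cup\mathcal{G}_1\cup H_1\cup\mathcal{G}_2\cup\cdots\cup H_{t-1}\cup\mathcal{G}_t\cup H_t$, where $\mathcal{G}_i=\mathcal{G}(a_i,b_i,c_i;m_i)$, by adding edges between arbitrary vertices of the first cell of $\mathcal{G}_i$ and arbitrary vertices of $H_{i-1}$, and between arbitrary vertices of the last cell of $\mathcal{G}_i$ and arbitrary vertices of $H_i$. The $\mathcal{G}_i$ are the major subgraphs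 of $\mathcal{G}$.
   Formalization: The family also admits t = 0 (G = H_0, of order at most C): with t positive the claim fails, e.g. for K_3 with d = 2, c = 2. For n > C the condition t ≥ 1 is automatic. *)

(* Defs.v *)
From mathcomp Require Import all_boot.

Set Implicit Arguments.
Unset Strict Implicit.
Unset Printing Implicit Defensive.

(* Finite simple graphs; the graph with no vertices is allowed. *)
Record sgraph := SGraph {
  vertex :> finType;
  edge : rel vertex;
  edge_sym : symmetric edge;
  edge_irr : irreflexive edge
}.

Arguments edge {s}.

Definition connected (G : sgraph) : Prop :=
  (0 < #|G|) /\ forall x y : G, connect edge x y.

Definition degree (G : sgraph) (x : G) : nat := #|[set y | edge x y]|.

(* The default value #|G| exceeds every degree, so it matters only when G has
   no vertices. *)
Definition min_degree (G : sgraph) : nat :=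
  \big[minn/#|G|]_(x : G) degree x.

Definition has_walk (G : sgraph) (x y : G) (k : nat) : bool :=
  [exists p : k.-tuple G, path edge x p && (last x p == y)].

(* The least length of a walk from x to y; equal to #|G| if there is none. *)
Definition dist (G : sgraph) (x y : G) : nat :=
  find (has_walk x y) (iota 0 #|G|).

Definition diam (G : sgraph) : nat := \max_(x : G) \max_(y : G) dist x y.

Section Complete.
Variable k : nat.

Definition complete_edge : rel 'I_k := fun x y => x != y.

Lemma complete_edge_sym : symmetric complete_edge.
Proof. by move=> x y; rewrite /complete_edge eq_sym. Qed.

Lemma complete_edge_irr : irreflexive complete_edge.
Proof. by move=> x; rewrite /complete_edge eqxx. Qed.

Definition complete : sgraph := SGraph complete_edge_sym complete_edge_irr.
End Complete.

Section DisjointUnion.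
Variables (I : finType) (G : I -> sgraph).

Definition dunion_edge : rel {i : I & G i} :=
  fun u v => (tag u == tag v) && edge (tagged u) (tagged_as u v).

Lemma dunion_edge_sym : symmetric dunion_edge.
Proof.
move=> [i x] [j y]; rewrite /dunion_edge /= [j == i]eq_sym.
by case: (eqVneq i j) y => //= <- y; rewrite !tagged_asE edge_sym.
Qed.

Lemma dunion_edge_irr : irreflexive dunion_edge.
Proof. by move=> [i x]; rewrite /dunion_edge tagged_asE edge_irr andbF. Qed.

Definition dunion : sgraph := SGraph dunion_edge_sym dunion_edge_irr.
End DisjointUnion.

Section DisjointUnion2.
Variables G1 G2 : sgraph.

Definition dunion2_edge : rel (G1 + G2)%type := fun u v =>
  match u, v with
  | inl x, inl y => edge x y
  | inr x, inr y => edge x y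
  | _, _ => false
  end.

Lemma dunion2_edge_sym : symmetric dunion2_edge.
Proof. by case=> x [] y //=; rewrite edge_sym. Qed.

Lemma dunion2_edge_irr : irreflexive dunion2_edge.
Proof. by case=> x /=; rewrite edge_irr. Qed.

Definition dunion2 : sgraph := SGraph dunion2_edge_sym dunion2_edge_irr.
End DisjointUnion2.

Section SequentialJoin.
Variables (k : nat) (G : 'I_k -> sgraph).

Definition seqjoin_edge : rel {i : 'I_k & G i} := fun u v =>
  [|| dunion_edge u v,
      (tag u).+1 == tag v :> nat | (tag v).+1 == tag u :> nat].

Lemma seqjoin_edge_sym : symmetric seqjoin_edge.
Proof.
by move=> u v; rewrite /seqjoin_edge dunion_edge_sym; congr (_ || _); rewrite orbC.
Qed.

Lemma seqjoin_edge_irr : irreflexive seqjoin_edge.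
Proof.
by move=> u; rewrite /seqjoin_edge dunion_edge_irr orbb gtn_eqF.
Qed.

Definition seqjoin : sgraph := SGraph seqjoin_edge_sym seqjoin_edge_irr.
End SequentialJoin.

(* The graph G(a,b,c;m). *)
Definition clique_chain (a b c m : nat) : sgraph :=
  seqjoin (fun i : 'I_(3 * m) => complete (nth 0 [:: a; b; c] (i %% 3))).

Definition cell (a b c m : nat) (u : clique_chain a b c m) : 'I_(3 * m) :=
  tag u.

Definition in_first_cell (a b c m : nat) (u : clique_chain a b c m) : bool :=
  cell u == 0 :> nat.

Definition in_last_cell (a b c m : nat) (u : clique_chain a b c m) : bool :=
  (cell u).+1 == 3 * m :> nat.

Section Family.
Variables (t : nat) (a b c m : 'I_t -> nat) (H : 'I_t.+1 -> sgraph).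

Definition major (i : 'I_t) : sgraph := clique_chain (a i) (b i) (c i) (m i).

(* H_0 u G_1 u H_1 u ... u G_t u H_t; since major subgraphs are indexed from 0
   here, [major i] lies between [H i] and [H i.+1]. *)
Definition base_graph : sgraph := dunion2 (dunion H) (dunion major).

Definition attachable_at (x : dunion H) (u : dunion major) : bool :=
  (tag x == tag u :> nat) && in_first_cell (tagged u)
  || (tag x == (tag u).+1 :> nat) && in_last_cell (tagged u).

Definition attachable (p q : base_graph) : bool :=
  match p, q with
  | inl x, inr u => attachable_at x u
  | inr u, inl x => attachable_at x u
  | _, _ => false
  end.

(* Up to isomorphism, G arises from the base graph by adding edges between
   attachable pairs. *)
Definition obtained_by_attaching (G : sgraph) : Prop :=
  exists2 f : base_graph -> G, bijective f &
    forall p q : base_graph,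
      (edge p q -> edge (f p) (f q)) /\
      (edge (f p) (f q) -> edge p q || attachable p q).
End Family.

(* The case t = 0 (then G is H_0, of order at most C) is included: without it,
   small graphs, such as K_3 for d = 2, would lie in no family. *)
Definition in_family (n d C : nat) (G : sgraph) : Prop :=
  exists (t : nat) (m a b c : 'I_t -> nat) (H : 'I_t.+1 -> sgraph),
    [/\ t <= C,
        forall i : 'I_t,
          [/\ 0 < m i, 0 < a i, 0 < b i, 0 < c i & a i + b i + c i = d.+1],
        \sum_(j < t.+1) #|H j| <= C,
        \sum_(i < t) m i * d.+1 + \sum_(j < t.+1) #|H j| = n
      & connected G /\ obtained_by_attaching a b c m H G].

(* Main.v *)
(* Let r be the distance from one end of a diametral path, D the diameter, and
   W_i the set of vertices y with |r y - i| <= 1.  For i <= D, W_i contains the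
   closed neighbourhood of some vertex, so |W_i| >= d + 1; on the other hand
   the |W_i| sum to at most 3n, and D is within a constant of 3n / (d + 1).
   Hence all but boundedly many i are tight, i.e. |W_i| = d + 1, and all layers
   have bounded size.  Every vertex of a tight layer is adjacent to all other
   vertices of W_i, and along a run of tight layers the sizes of the layers have
   period 3.  So three or more consecutive tight layers, up to at most two of
   them, form a clique chain, while all remaining layers go into the H_j. *)
Require Import Defs.
From HB Require Import structures.
From mathcomp Require Import all_boot all_order all_algebra.
From mathcomp Require Import reals zify lra.
Set Implicit Arguments.
Unset Strict Implicit.
Unset Printing Implicit Defensive.
Import Order.TTheory GRing.Theory Num.Theory.

Lemma min_degree_le (G : sgraph) (x : G) : min_degree G <= degree x.
Proof.
rewrite /min_degree; have := mem_index_enum x.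
elim: (index_enum _) => //= y s IHs; rewrite inE big_cons.
by case/predU1P => [<-|/IHs]; [apply: geq_minl | apply/leq_trans/geq_minr].
Qed.

(** * Distances and nonempty distance layers *)

Section Distance.
Variable G : sgraph.
Implicit Types x y z : G.

Lemma dist_le_walk x y k : has_walk x y k -> dist x y <= k.
Proof.
move=> walk_k; have [lt_k|] := ltnP k #|G|; last first.
  by apply: leq_trans; rewrite -[leqRHS](size_iota 0) find_size.
rewrite leqNgt; apply/negP => /(before_find 0).
by rewrite nth_iota // add0n walk_k.
Qed.

Lemma walk_dist x y : dist x y < #|G| -> has_walk x y (dist x y).
Proof.
move=> lt_d; have : has (has_walk x y) (iota 0 #|G|).
  by rewrite has_find size_iota.
by move/(nth_find 0); rewrite nth_iota // add0n.
Qed.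

Lemma dist_edge x y z : edge y z -> dist x z <= (dist x y).+1.
Proof.
(* Without a walk from [x] to [y], [dist x y] takes its default [#|G|], which no distance
   exceeds. *)
move=> yz; have [lt_d|ge_d] := ltnP (dist x y) #|G|; last first.
  rewrite ltnW // ltnS (leq_trans _ ge_d) //.
  by rewrite -[leqRHS](size_iota 0) find_size.
have /existsP [p /andP [xp /eqP lst]] := walk_dist lt_d.
apply: dist_le_walk; apply/existsP.
exists [tuple of rcons p z]; rewrite /= rcons_path xp lst yz.
by rewrite last_rcons eqxx.
Qed.

Lemma dist_xx x : dist x x = 0.
Proof.
apply/eqP; rewrite -leqn0; apply: dist_le_walk.
by apply/existsP; exists [tuple]; rewrite /= eqxx.
Qed.

Lemma diam_attained : 0 < #|G| -> exists x y, diam G = dist x y.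
Proof.
move=> G0; rewrite /diam.
have [x ->] := @bigop.eq_bigmax G (fun x => \max_(y : G) dist x y) G0.
by have [y ->] := @bigop.eq_bigmax G (dist x) G0; exists x, y.
Qed.

Lemma dist_le_diam x y : dist x y <= diam G.
Proof.
apply: leq_trans (bigop.leq_bigmax (F := dist x) y) _.
exact: (bigop.leq_bigmax (F := fun x => \max_(y : G) dist x y) x).
Qed.

(** Along a path from [x] the distance starts at 0 and grows by at most one per edge, so it skips no
    value. *)
Lemma level_nonempty x y i :
  connect edge x y -> i <= dist x y -> exists z, dist x z = i.
Proof.
case/connectP => p; elim/last_ind: p y => [|p z IHp] y /=.
  by move=> _ ->; rewrite dist_xx leqn0 => /eqP ->; exists x; rewrite dist_xx.
rewrite rcons_path last_rcons => /andP [xp lz] ->.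
rewrite leq_eqVlt => /predU1P [->|lt_i]; first by exists z.
by apply: IHp xp erefl _; rewrite -ltnS (leq_trans lt_i) ?dist_edge.
Qed.
End Distance.

(* [0, N) is cut into the consecutive intervals
   [e 0, s 0), [s 0, e 1), [e 1, s 1), ..., [s (t-1), e t), [e t, s t):
   the layers in [s j, e (j+1)) will form the j-th major subgraph and those in
   [e j, s j) the graph H_j.  An inner gap must be nonempty, otherwise the two
   major subgraphs around it would be joined to each other. *)
Definition decomposition (good : pred nat) (N t : nat) (s e : nat -> nat) :=
  [/\ e 0 = 0, s t = N,
      forall j, j <= t -> e j <= s j,
      forall j, 0 < j < t -> e j < s j &
      forall j, j < t ->
        [/\ s j < e j.+1, 3 %| e j.+1 - s j &
            forall i, s j <= i < e j.+1 -> good i]].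

Definition gap_total (t : nat) (s e : nat -> nat) := \sum_(j < t.+1) (s j - e j).

(** * Existence of a decomposition with few gap layers *)

Section Decomposition.
Variable good : pred nat.

Lemma gap_total_last t (s s' e e' : nat -> nat) :
  (forall j, j < t -> s j = s' j) -> (forall j, j < t -> e j = e' j) ->
  gap_total t s e + (s' t - e' t) = gap_total t s' e' + (s t - e t).
Proof.
move=> eqs eqe; rewrite /gap_total !big_ord_recr /=.
rewrite addnAC; congr (_ + _ + _).
by apply: eq_bigr => j _; rewrite eqs ?eqe.
Qed.

(** Only the right end of the last gap moves, and it lies beyond all major intervals. *)
Lemma decomposition_enlarge_last N t s e k :
  decomposition good N t s e ->
  let s' := fun j => if j == t then N + k else s j in
  decomposition good (N + k) t s' e /\
  gap_total t s' e = gap_total t s e + k.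
Proof.
move=> [e0 st les lts maj] s'; split.
  split; rewrite /s' ?eqxx //.
  - move=> j; case: eqP => [-> _|_ /les //].
    by rewrite (leq_trans (les t _)) // st leq_addr.
  - by move=> j; case: eqP => [-> | _ /lts //]; rewrite ltnn andbF.
  - by move=> j jt; rewrite ltn_eqF //; apply: maj.
have eq_s j : j < t -> s j = s' j by rewrite /s' => jt; rewrite ltn_eqF.
have := gap_total_last eq_s (fun j _ => erefl (e j)).
have := les t (leqnn t); rewrite /s' eqxx st; lia.
Qed.

(** The first [k %% 3] indices extend the last gap; the rest, if any, become a new major interval
    followed by an empty gap. The old last gap may then become inner, so it must be nonempty unless
    it is gap 0. *)
Lemma decomposition_good_run N t s e k :
  decomposition good N t s e -> (t == 0) || (e t < N) ->
  (forall i, N <= i < N + k -> good i) ->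
  exists t' s' e', decomposition good (N + k) t' s' e' /\
    gap_total t' s' e' <= gap_total t s e + 2.
Proof.
move=> dec last_ok run.
have [lt_k3|le_3k] := ltnP k 3.
  have [dec' gap'] := decomposition_enlarge_last k dec.
  by do 3 eexists; split; [exact: dec'|rewrite gap'; lia].
have [] := decomposition_enlarge_last (k %% 3) dec.
set s1 := fun j => _; move=> [e0 s1t les lts maj] gap1.
pose s' j := if j == t.+1 then N + k else s1 j.
pose e' j := if j == t.+1 then N + k else e j.
exists t.+1, s', e'; split; last first.
  rewrite {1}/gap_total big_ord_recr /= /s' /e' eqxx subnn addn0.
  rewrite (eq_bigr (fun j : 'I_t.+1 => s1 j - e j)) => [|j _].
    by rewrite -/(gap_total t s1 e) gap1; lia.
  by rewrite ltn_eqF.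
split; rewrite /s' /e' ?eqxx //.
- by move=> j; case: eqP => // /eqP ? ?; apply: les; lia.
- move=> j /andP [j0 jt]; rewrite ltn_eqF //.
  have [jt'|] := ltnP j t; first by apply: lts; lia.
  move=> tj; have -> : j = t by lia.
  move: last_ok; rewrite s1t; lia.
- move=> j jt; rewrite eqSS ltn_eqF //.
  case: eqP => [->|/eqP jt']; last by apply: maj; lia.
  rewrite s1t; split; [lia|lia|].
  by move=> i ?; apply: run; lia.
Qed.

(* A maximal run of good indices, cut into triples, leaves at most two indices
   outside the major subgraphs and is ended by a bad one. *)
Lemma decomposition_exists N :
  exists t s e, decomposition good N t s e /\
    gap_total t s e <= 3 * \sum_(i < N) ~~ good i + 2.
Proof.
(* [[q, q + k)] is the current run of good indices, kept pending until a bad index or the end closes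
   it. Closing it costs at most two gap indices, hence the final [+ 2]. *)
suff [q [k [t [s [e [eqN dec last_ok gap run]]]]]] :
  exists q k t s e, [/\ N = q + k, decomposition good q t s e,
    (t == 0) || (e t < q), gap_total t s e <= 3 * \sum_(i < N) ~~ good i &
    forall i, q <= i < q + k -> good i].
  have [t' [s' [e' [dec' gap']]]] := decomposition_good_run dec last_ok run.
  by exists t', s', e'; split; [rewrite eqN | rewrite (leq_trans gap') ?leq_add2r].
elim: N => [|N [q [k [t [s [e [eqN dec last_ok gap run]]]]]]].
  exists 0, 0, 0, (fun=> 0), (fun=> 0); split=> //.
    by split=> // j; rewrite ltn0 ?andbF.
  by rewrite /gap_total big_ord_recr big_ord0.
rewrite big_ord_recr /=; move: (\sum_(i < N) _) gap => bad gap.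
case gN: (good N) => /=.
  exists q, k.+1, t, s, e; split=> //; [lia|lia|].
  move=> i ?; have [->//|/eqP ?] := eqVneq i N; apply: run; lia.
(* The bad index closes the pending run and joins the last gap, at a cost of at most 2 + 1. This
   gives the factor 3 and leaves the last gap nonempty. *)
have [t' [s' [e' [dec' gap']]]] := decomposition_good_run dec last_ok run.
have [dec2 gap2] := decomposition_enlarge_last 1 dec'.
exists N.+1, 0, t'; do 2 eexists; split; [lia| | | |].
- by rewrite eqN -addn1; exact: dec2.
- by case: dec' => _ st /(_ t' (leqnn _)); rewrite st; lia.
- by rewrite gap2; lia.
- lia.
Qed.
End Decomposition.

(** * Order relations between the intervals *)

Section DecompositionTheory.
Variables (good : pred nat) (N t : nat) (s e : nat -> nat).
Hypothesis dec : decomposition good N t s e.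

Lemma decomposition_es j : j <= t -> e j <= s j.
Proof. by case: dec => _ _ + _ _; apply. Qed.

(** The length of a major interval is positive and divisible by 3. *)
Lemma decomposition_se j : j < t -> s j + 3 <= e j.+1.
Proof. case: dec => _ _ _ _ /[apply] -[? ? _]; lia. Qed.

Lemma decomposition_e_lt j k : j < k <= t -> s j + 3 <= e k.
Proof.
case/andP; elim: k => // k IHk; rewrite ltnS leq_eqVlt => /predU1P[->|jk] kt.
  exact: decomposition_se.
have := decomposition_se kt; have := decomposition_es (ltnW kt).
have := IHk jk (ltnW kt); lia.
Qed.

Lemma decomposition_e_le j k : j <= k <= t -> e j <= e k.
Proof.
case/andP; rewrite leq_eqVlt => /predU1P[->//|jk] kt.
have := @decomposition_e_lt j k; rewrite jk kt => /(_ isT).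
have := @decomposition_es j; lia.
Qed.

Lemma decomposition_s_lt j k : j < k <= t -> s j + 3 <= s k.
Proof.
move=> jk; apply: leq_trans (decomposition_e_lt jk) _.
by apply: decomposition_es; case/andP: jk.
Qed.

(** Strict because inner gaps are nonempty; this later excludes edges between different major
    subgraphs. *)
Lemma decomposition_e_lt_s j k : j < k < t -> e j.+1 < s k.
Proof.
move=> jk; have lt_k : e k < s k by case: dec => _ _ _ + _; apply; lia.
apply: leq_ltn_trans lt_k; apply: decomposition_e_le; lia.
Qed.

Lemma decomposition_cover i : i < N ->
  (exists2 j, j <= t & e j <= i < s j) \/
  (exists2 j, j < t & s j <= i < e j.+1).
Proof.
case: dec => e0 st _ _ _ iN.
have : exists j, (j <= t) && (i < s j) by exists t; rewrite st iN leqnn.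
(* For the least [j] with [i < s j], the index [i] lies in gap [j] or in the major interval just
   before it. *)
case/ex_minnP => j /andP [jt ij] minj.
have [ej|ej] := leqP (e j) i; first by left; exists j => //; rewrite ej.
right; case: j => [|j] in jt ij minj ej *; first by move: ej; rewrite e0.
exists j => //; rewrite ej andbT leqNgt; apply/negP => isj.
by have := minj j; rewrite isj (ltnW jt) ltnn => /(_ isT).
Qed.

(** All gaps but the first and the last are inner, so each of them contributes at least one. *)
Lemma decomposition_t_le : t <= gap_total t s e + 1.
Proof.
case: t dec => // u dec'; rewrite /gap_total big_ord_recl big_ord_recr /=.
have : \sum_(j < u) 1 <= \sum_(j < u) (s (bump 0 j) - e (bump 0 j)).
  apply: leq_sum => j _; case: dec' => _ _ _ lts _.
  by rewrite subn_gt0 lts //= /bump leq0n add1n ltnS ltn_ord.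
rewrite sum1_card card_ord; move: (\sum_(j < u) _) => S; lia.
Qed.
End DecompositionTheory.

Section Induced.
Variables (G : sgraph) (P : pred G).

Definition induced_edge : rel {x : G | P x} := fun u v => edge (val u) (val v).

Lemma induced_edge_sym : symmetric induced_edge.
Proof. by move=> u v; apply: edge_sym. Qed.

Lemma induced_edge_irr : irreflexive induced_edge.
Proof. by move=> u; apply: edge_irr. Qed.

Definition induced : sgraph := SGraph induced_edge_sym induced_edge_irr.
End Induced.

(** * Windows and tight layers *)

Section Layers.
(** [r] stands for the distance from one end of a diametral path and [N] for the number of layers,
    the diameter plus one. *)
Variables (G : sgraph) (d N : nat) (r : G -> nat).
Hypothesis r_edge : forall y z, edge y z -> r z <= (r y).+1.
Hypothesis r_lt : forall y, r y < N.
Hypothesis r_onto : forall i, i < N -> exists y, r y = i.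
Hypothesis degree_ge : forall y : G, d <= degree y.

Definition layer i : {set G} := [set y | r y == i].
Definition window i : {set G} := [set y | (r y <= i.+1) && (i <= (r y).+1)].
Definition tight i := #|window i| == d.+1.

Lemma closed_nbhd_window (y : G) : y |: [set z | edge y z] \subset window (r y).
Proof.
apply/subsetP => z; rewrite !inE => /predU1P [->|yz]; first by rewrite !leqnSn.
by rewrite r_edge // r_edge // edge_sym.
Qed.

Lemma closed_nbhd_card (y : G) : #|y |: [set z | edge y z]| = (degree y).+1.
Proof. by rewrite cardsU1 inE edge_irr. Qed.

Lemma window_ge i : i < N -> d.+1 <= #|window i|.
Proof.
move=> /r_onto [y <-]; apply: leq_trans (subset_leq_card (closed_nbhd_window y)).
by rewrite closed_nbhd_card ltnS degree_ge.
Qed.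

(** The second bound carries the induction: it is at most 2 whenever the new index [n] counts. *)
Lemma sum_near_le3 n k :
  \sum_(i < n) (k <= i.+1) && (i <= k.+1) <= minn 3 (n.+1 - k).
Proof.
elim: n => [|n IHn]; first by rewrite big_ord0.
rewrite big_ord_recr /=; move: (\sum_(i < n) _) IHn => S; lia.
Qed.

(** Double counting: each vertex lies in at most three windows. *)
Lemma sum_window : \sum_(i < N) #|window i| <= 3 * #|G|.
Proof.
under eq_bigr => i _ do rewrite -sum1_card big_mkcond /=.
rewrite exchange_big /= mulnC -[#|G|]sum1_card big_distrl /=.
apply: leq_sum => y _; rewrite mul1n.
apply: leq_trans (geq_minl 3 (N.+1 - r y)); apply: leq_trans (sum_near_le3 N (r y)).
by apply: leq_sum => i _; rewrite inE; case: (_ && _).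
Qed.

(** A window that is not tight exceeds [d.+1] by at least one, and the total excess is at most
    [K]. *)
Lemma sum_not_tight K :
  3 * #|G| + d.+1 <= N * d.+1 + K -> \sum_(i < N) ~~ tight i <= K.
Proof.
move=> order_le.
have : \sum_(i < N) (d.+1 + ~~ tight i) <= \sum_(i < N) #|window i|.
  apply: leq_sum => i _; have := window_ge (ltn_ord i).
  by rewrite /tight; case: ltngtP => //; lia.
rewrite big_split sum_nat_const card_ord /=.
have := sum_window; move: (\sum_(i < N) _) (\sum_(i < N) #|_|) => S S'; lia.
Qed.

(** The other [N.-1] windows use up at least [d.+1] each, which leaves at most [K] for the window
    around layer [i]. *)
Lemma layer_le K i :
  3 * #|G| + d.+1 <= N * d.+1 + K -> i < N -> #|layer i| <= K.
Proof.
move=> order_le iN; have : #|window i| + N.-1 * d.+1 <= \sum_(j < N) #|window j|.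
  rewrite (bigD1 (Ordinal iN)) //= leq_add2l.
  have -> : N.-1 * d.+1 = \sum_(j < N | j != Ordinal iN) d.+1.
    by rewrite sum_nat_const cardC1 card_ord.
  by apply: leq_sum => j _; apply: window_ge.
have : #|layer i| <= #|window i|.
  by apply/subset_leq_card/subsetP => y; rewrite !inE => /eqP ->; rewrite !leqnSn.
have := sum_window; move: (\sum_(j < N) _) => S.
case: N iN order_le => //= M _; lia.
Qed.

Lemma layer_gt0 i : i < N -> 0 < #|layer i|.
Proof. by case/r_onto => y ry; apply/card_gt0P; exists y; rewrite inE ry. Qed.

(** The closed neighbourhood of [y] has at least [d.+1] vertices and lies in a window of exactly
    that size, so the two coincide. *)
Lemma tight_edge (y z : G) :
  tight (r y) -> edge y z = (z != y) && (z \in window (r y)).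
Proof.
move=> /eqP ty; have <- : y |: [set z | edge y z] = window (r y).
  apply/eqP; rewrite eqEcard closed_nbhd_window closed_nbhd_card ty ltnS.
  exact: degree_ge.
by rewrite !inE; case: eqVneq => //= ->; rewrite edge_irr.
Qed.

Lemma card_window i :
  #|window i.+1| = #|layer i| + #|layer i.+1| + #|layer i.+2|.
Proof.
have -> : window i.+1 = layer i :|: layer i.+1 :|: layer i.+2.
  by apply/setP => y; rewrite !inE; lia.
rewrite !cardsU (_ : layer i :&: layer i.+1 = set0) ?cards0 ?subn0.
  rewrite (_ : (_ :|: _) :&: _ = set0) ?cards0 ?subn0 //.
  by apply/setP => y; rewrite !inE; lia.
by apply/setP => y; rewrite !inE; lia.
Qed.

Lemma tight_layer_sum i :
  tight i.+1 -> #|layer i| + #|layer i.+1| + #|layer i.+2| = d.+1.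
Proof. by rewrite -card_window => /eqP. Qed.

(** The two windows have equal size and share their two middle layers. *)
Lemma tight_periodic i : tight i.+1 -> tight i.+2 -> #|layer i.+3| = #|layer i|.
Proof. by move=> /tight_layer_sum + /tight_layer_sum; lia. Qed.

Lemma tight_run_card p k i :
  (forall i, p <= i < p + k -> tight i) -> i < k ->
  #|layer (p + i)| = nth 0 [:: #|layer p|; #|layer p.+1|; #|layer p.+2|] (i %% 3).
Proof.
move=> run; have [n] := ubnP i; elim: n i => // n IHn [|[|[|i]]] lt_n lt_k /=.
- by rewrite addn0.
- by rewrite addn1.
- by rewrite addn2.
rewrite -addn3 modnDr -IHn; [|lia|lia].
by rewrite addn3 !addnS tight_periodic //; apply: run; lia.
Qed.

Lemma card_layer_range K p q : (forall i, i < q -> #|layer i| <= K) ->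
  #|[set y | p <= r y < q]| <= (q - p) * K.
Proof.
elim: q => [|q IHq] le_K.
  by rewrite (_ : [set y | _] = set0) ?cards0 //; apply/setP => y; rewrite !inE; lia.
have [le_pq|lt_qp] := leqP p q; last first.
  by rewrite (_ : [set y | _] = set0) ?cards0 //; apply/setP => y; rewrite !inE; lia.
rewrite (_ : [set y | _] = [set y | p <= r y < q] :|: layer q); last first.
  by apply/setP => y; rewrite !inE; lia.
apply: leq_trans (leq_card_setU _ _) _.
have := le_K q (ltnSn q); have := IHq (fun i iq => le_K i (ltnW iq)).
by rewrite subSn // mulSn; lia.
Qed.

(** * The base graph of a decomposition and its embedding into [G] *)

Variables (t : nat) (s e : nat -> nat).
Hypothesis dec : decomposition tight N t s e.
Variable x0 : G.

Definition gap (j : 'I_t.+1) : sgraph := induced [pred y | e j <= r y < s j].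
(** [len], [size0], [size1], [size2] serve as the parameters m, a, b, c of the major subgraphs. *)
Definition len (j : 'I_t) := (e j.+1 - s j) %/ 3.
Definition size0 (j : 'I_t) := #|layer (s j)|.
Definition size1 (j : 'I_t) := #|layer (s j).+1|.
Definition size2 (j : 'I_t) := #|layer (s j).+2|.

Let base := base_graph size0 size1 size2 len gap.

Lemma len3 j : 3 * len j = e j.+1 - s j.
Proof.
by case: dec => _ _ _ _ /(_ j (ltn_ord j)) [_ dvd _]; rewrite mulnC divnK.
Qed.

Lemma run_tight (j : 'I_t) i : s j <= i < e j.+1 -> tight i.
Proof. by case: dec => _ _ _ _ /(_ j (ltn_ord j)) [_ _]; apply. Qed.

Lemma e_le_N j : j <= t -> e j <= N.
Proof.
move=> jt; have <- : s t = N by case: dec.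
apply: leq_trans (decomposition_es dec (leqnn t)).
by apply: (decomposition_e_le dec); rewrite jt leqnn.
Qed.

Lemma s_le_N j : j <= t -> s j <= N.
Proof.
move=> jt; have <- : s t = N by case: dec.
case: (ltngtP j t) jt => // [lt_jt _|-> //].
by have := @decomposition_s_lt _ _ _ _ _ dec j t; rewrite lt_jt leqnn => /(_ isT); lia.
Qed.

Lemma len_gt0 j : 0 < len j.
Proof. have := len3 j; have := decomposition_se dec (ltn_ord j); lia. Qed.

Lemma sizes_gt0 j : [/\ 0 < size0 j, 0 < size1 j & 0 < size2 j].
Proof.
have := decomposition_se dec (ltn_ord j).
by have := e_le_N (ltn_ord j); split; apply: layer_gt0; lia.
Qed.

Lemma sizes_sum j : size0 j + size1 j + size2 j = d.+1.
Proof.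
apply/tight_layer_sum/(run_tight (j := j)).
have := decomposition_se dec (ltn_ord j); lia.
Qed.

Lemma cell_size j (i : 'I_(3 * len j)) :
  nth 0 [:: size0 j; size1 j; size2 j] (i %% 3) = #|layer (s j + i)|.
Proof.
rewrite (@tight_run_card _ (3 * len j)) // => k ks; apply: (run_tight (j := j)).
have := len3 j; have := decomposition_se dec (ltn_ord j); lia.
Qed.

(** The default [x0] is never reached, since by [cell_size] a cell has as many vertices as its
    layer. The order of enumeration is immaterial, since adjacency in a tight run depends only on
    the layers. *)
Definition embed_major j (u : major size0 size1 size2 len j) : G :=
  nth x0 (enum (layer (s j + tag u))) (tagged u).

Definition embed (p : base) : G :=
  match p with
  | inl x => val (tagged x)
  | inr u => embed_major (tagged u)
  end.

Lemma embed_major_mem j (u : major size0 size1 size2 len j) :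
  embed_major u \in layer (s j + tag u).
Proof.
case: u => i k; rewrite /embed_major -mem_enum mem_nth // -cardE -cell_size.
exact: ltn_ord.
Qed.

Lemma r_embed_major j (u : major size0 size1 size2 len j) :
  r (embed_major u) = s j + tag u.
Proof. by have := embed_major_mem u; rewrite inE => /eqP. Qed.

Lemma r_embed_major_range j (u : major size0 size1 size2 len j) :
  s j <= r (embed_major u) < e j.+1.
Proof.
rewrite r_embed_major; have := len3 j; have := ltn_ord (tag u).
have := decomposition_se dec (ltn_ord j); lia.
Qed.

Lemma embed_major_inj j : injective (@embed_major j).
Proof.
move=> u v eq_uv; have := congr1 r eq_uv; rewrite !r_embed_major => /addnI/val_inj.
case: u v eq_uv => [i k] [i' k'] /= eq_uv eq_i; case: i' / eq_i k' eq_uv => k'.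
have lt_k (l : complete (nth 0 [:: size0 j; size1 j; size2 j] (i %% 3))) :
    l < size (enum (layer (s j + i))).
  by rewrite -cardE -cell_size ltn_ord.
move/eqP; rewrite /embed_major /= nth_uniq ?enum_uniq //.
by move=> /eqP/val_inj ->.
Qed.

(** Two different gaps are separated by at least three layers. With [y = z] this serves injectivity,
    with adjacent [y] and [z] the edges. *)
Lemma gap_index_eq (j k : 'I_t.+1) y z : r z <= (r y).+1 -> r y <= (r z).+1 ->
  e j <= r y < s j -> e k <= r z < s k -> j = k.
Proof.
move=> ryz rzy yj zk; apply: val_inj => /=.
have := ltn_ord j; have := ltn_ord k; case: (ltngtP j k) => // jk ? ?.
  by have := @decomposition_e_lt _ _ _ _ _ dec j k; lia.
by have := @decomposition_e_lt _ _ _ _ _ dec k j; lia.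
Qed.

Lemma major_index_eq (j k : 'I_t) y z : r z <= (r y).+1 -> r y <= (r z).+1 ->
  s j <= r y < e j.+1 -> s k <= r z < e k.+1 -> j = k.
Proof.
move=> ryz rzy yj zk; apply: val_inj => /=.
have := ltn_ord j; have := ltn_ord k; case: (ltngtP j k) => // jk ? ?.
  by have := @decomposition_e_lt_s _ _ _ _ _ dec j k; lia.
by have := @decomposition_e_lt_s _ _ _ _ _ dec k j; lia.
Qed.

(** A gap touches only the last layer of the run before it and the first layer of the run after it.
    The strict inequalities show that a gap and a run share no vertex. *)
Lemma gap_major_adjacent (j : 'I_t.+1) (k : 'I_t) y z :
  r z <= (r y).+1 -> r y <= (r z).+1 ->
  e j <= r y < s j -> s k <= r z < e k.+1 ->
  (j = k :> nat) /\ r z = s k /\ r y < r z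
  \/ (j = k.+1 :> nat) /\ (r z).+1 = e k.+1 /\ r z < r y.
Proof.
move=> ryz rzy yj zk; have := ltn_ord j; have := ltn_ord k.
have := @decomposition_es _ _ _ _ _ dec k.
case: (ltngtP j k) => jk.
- by have := @decomposition_s_lt _ _ _ _ _ dec j k; lia.
- have [jk1|jk1] := eqVneq (j : nat) k.+1.
    by rewrite jk1 in yj *; right; split=> //; lia.
  by have := @decomposition_e_lt _ _ _ _ _ dec k.+1 j;
    have := decomposition_es dec (ltn_ord k); lia.
- by rewrite jk in yj *; left; split=> //; lia.
Qed.

Lemma embed_inj : injective embed.
Proof.
move=> [[j x]|[j u]] [[k y]|[k v]] eq_p; have := congr1 r eq_p.
- move: eq_p => /= eq_p _; have := valP x; have := valP y; rewrite /= -eq_p => ry rx.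
  have eq_jk := gap_index_eq (leqnSn _) (leqnSn _) rx ry.
  by case: k / eq_jk y eq_p {ry} => y /val_inj ->.
- move=> /= eq_r; have := gap_major_adjacent _ _ (valP x) (r_embed_major_range v).
  by rewrite /= eq_r ltnn leqnSn => /(_ isT isT) [] [_ []].
- move=> /= eq_r; have := gap_major_adjacent _ _ (valP y) (r_embed_major_range u).
  by rewrite /= eq_r ltnn leqnSn => /(_ isT isT) [] [_ []].
- move: eq_p => /= eq_p _; have ru := r_embed_major_range u.
  have rv := r_embed_major_range v; rewrite -eq_p in rv.
  have eq_jk := major_index_eq (leqnSn _) (leqnSn _) ru rv.
  by case: k / eq_jk v eq_p {rv} => v /embed_major_inj ->.
Qed.

Lemma embed_surj y : exists p, embed p = y.
Proof.
case: (decomposition_cover dec (r_lt y)) => -[j jt rj].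
  pose j' : 'I_t.+1 := Ordinal (n := t.+1) (m := j) jt.
  by exists (inl (Tagged (fun j => vertex (gap j)) (exist _ y rj : gap j'))).
pose j' := Ordinal jt.
have lt_i : r y - s j < 3 * len j' by rewrite len3 /=; lia.
have memy : y \in layer (s j' + Ordinal lt_i) by rewrite inE /= subnKC //; lia.
have lt_k : index y (enum (layer (s j' + Ordinal lt_i))) <
    nth 0 [:: size0 j'; size1 j'; size2 j'] (Ordinal lt_i %% 3).
  by rewrite cell_size cardE index_mem mem_enum.
pose u : major size0 size1 size2 len j' :=
  Tagged (fun i : 'I_(3 * len j') => vertex (complete
    (nth 0 [:: size0 j'; size1 j'; size2 j'] (i %% 3)))) (Ordinal lt_k).
exists (inr (Tagged (fun j => vertex (major size0 size1 size2 len j)) u)).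
by rewrite /= /embed_major /= nth_index // mem_enum.
Qed.

Lemma embed_bij : bijective embed.
Proof.
have G_base (y : G) : {p | embed p == y}.
  by apply: sigW; have [p <-] := embed_surj y; exists p.
exists (fun y => sval (G_base y)) => [p|y]; last exact/eqP/(svalP (G_base y)).
by apply: embed_inj; apply/eqP/(svalP (G_base (embed p))).
Qed.

(** By tightness, distinct images are adjacent exactly when their layers differ by at most one, as
    in a sequential join of cliques. *)
Lemma embed_major_edge j (u v : major size0 size1 size2 len j) :
  edge (embed_major u) (embed_major v) = edge u v.
Proof.
rewrite tight_edge; last by apply/run_tight/r_embed_major_range.
rewrite inE (inj_eq (@embed_major_inj j)) !r_embed_major.
case: u v => [i k] [i' k']; rewrite /edge /= /seqjoin_edge /dunion_edge /=.
case: (eqVneq i i') k' => [<- k'|ne_i k']; last first.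
  have ne_n : (i : nat) <> i' by move/val_inj/eqP; rewrite (negPf ne_i).
  rewrite (_ : (_ != _) = true) /=; first by lia.
  by apply/eqP => /(congr1 (@tag _ _))/= /esym/eqP; rewrite (negPf ne_i).
rewrite tagged_asE /edge /= /complete_edge !leqnSn !andbT.
rewrite gtn_eqF // orbb orbF eq_sym; congr (~~ _).
by apply/eqP/eqP => [|-> //]; apply: eq_from_Tagged.
Qed.

(** Adjacent vertices lie at most one layer apart, so an edge stays within one gap or one run, or
    joins a gap to an end cell of a neighbouring run. *)
Lemma embed_attaching : obtained_by_attaching size0 size1 size2 len gap G.
Proof.
exists embed; first exact: embed_bij.
have r_near y z : edge y z -> r z <= (r y).+1 /\ r y <= (r z).+1.
  by move=> yz; rewrite !r_edge // edge_sym.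
have attach (j : 'I_t.+1) (x : gap j) (k : 'I_t) (u : major size0 size1 size2 len k) :
    edge (val x) (embed_major u) ->
    attachable_at (Tagged (fun j => vertex (gap j)) x)
      (Tagged (fun k => vertex (major size0 size1 size2 len k)) u).
  case/r_near => rxu rux; rewrite /attachable_at /in_first_cell /in_last_cell /cell /=.
  have := gap_major_adjacent rxu rux (valP x) (r_embed_major_range u).
  rewrite r_embed_major => -[[jk [ru _]]|[jk [ru _]]]; rewrite jk eqxx /=.
    by move: ru; rewrite -{2}[s k]addn0 => /addnI ->.
  apply/orP; right; apply/eqP.
  by rewrite -[LHS](addKn (s k)) addnS ru; apply/esym/len3.
move=> [[j x]|[j u]] [[k y]|[k v]]; split=> //=.
- by case/andP => /= /eqP eq_jk; case: k / eq_jk y => y; rewrite tagged_asE.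
- move=> xy; have [rxy ryx] := r_near _ _ xy.
  have eq_jk := gap_index_eq rxy ryx (valP x) (valP y).
  case: k / eq_jk y xy {rxy ryx} => y xy.
  by rewrite /edge /= /dunion_edge /= eqxx tagged_asE orbF.
- exact: attach.
- by rewrite edge_sym; apply: attach.
- case/andP => /= /eqP eq_jk; case: k / eq_jk v => v.
  by rewrite tagged_asE embed_major_edge.
- move=> uv; have [ruv rvu] := r_near _ _ uv.
  have eq_jk := major_index_eq ruv rvu (r_embed_major_range u) (r_embed_major_range v).
  case: k / eq_jk v uv {ruv rvu} => v; rewrite embed_major_edge => uv.
  by rewrite /edge /= /dunion_edge /= eqxx tagged_asE orbF.
Qed.

Lemma sum_gap K : (forall i, i < N -> #|layer i| <= K) ->
  \sum_(j < t.+1) #|gap j| <= gap_total t s e * K.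
Proof.
move=> le_K; rewrite /gap_total big_distrl; apply: leq_sum => j _ /=.
rewrite card_sig -cardsE; apply: card_layer_range => i iq.
by apply: le_K; apply: leq_trans iq _; apply: s_le_N; rewrite -ltnS.
Qed.

(** Each period of three cells contributes [d.+1] vertices by [sizes_sum]. *)
Lemma card_major j : #|major size0 size1 size2 len j| = len j * d.+1.
Proof.
rewrite card_tagged sumnE big_map -(sizes_sum j) /=.
under eq_bigr => i _ do rewrite card_ord.
rewrite big_enum /= -(big_mkord xpredT (fun i => nth 0 [:: size0 j; size1 j; size2 j] (i %% 3))).
elim: (len j) => [|m IHm]; first by rewrite big_geq.
rewrite mulnSr !addnS addn0 !big_nat_recr //= IHm mulSn.
have mod3 i : (3 * m + i) %% 3 = i %% 3 by rewrite mulnC modnMDl.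
have := mod3 0; have := mod3 1; have := mod3 2.
rewrite !addnS !addn0 => -> -> -> /=; lia.
Qed.

Lemma card_base : \sum_(j < t) len j * d.+1 + \sum_(j < t.+1) #|gap j| = #|G|.
Proof.
have [g _ _] := embed_bij; rewrite -(bij_eq_card embed_bij) card_sum !card_tagged.
rewrite !sumnE !big_map -!enumT !big_enum /= addnC; congr (_ + _).
by apply: eq_bigr => j _; rewrite card_major.
Qed.
End Layers.

(** * Assembly and choice of the constant *)

Lemma near_extremal_in_family (G : sgraph) (d K : nat) :
  connected G -> min_degree G = d -> 3 * #|G| <= diam G * d.+1 + K ->
  in_family #|G| d ((3 * K + 2) * K.+1 + 1) G.
Proof.
move=> conG mindeg diam_ge; have [G0 con] := conG.
have [x [y eq_diam]] := diam_attained G0; pose N := (diam G).+1.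
have r_edge (u v : G) : edge u v -> dist x v <= (dist x u).+1.
  exact: dist_edge.
have r_lt (u : G) : dist x u < N by rewrite ltnS dist_le_diam.
have r_onto i : i < N -> exists u : G, dist x u = i.
  by rewrite ltnS eq_diam; apply: level_nonempty.
have degree_ge (u : G) : d <= degree u by rewrite -mindeg min_degree_le.
have order_le : 3 * #|G| + d.+1 <= N * d.+1 + K by rewrite /N mulSn; lia.
have [t [s [e [dec gap_le]]]] := decomposition_exists (tight d (dist x)) N.
(* At most [3 * K + 2] gap layers of at most [K] vertices each bound the order of the [H_j], and [t]
   is at most [3 * K + 3]; the constant covers both. *)
have {}gap_le : gap_total t s e <= 3 * K + 2.
  apply: leq_trans gap_le _; rewrite leq_add2r leq_mul2l.
  by apply: sum_not_tight order_le.
exists t, (len s e), (size0 (dist x) s), (size1 (dist x) s), (size2 (dist x) s).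
exists (gap (dist x) s e); split.
- have := decomposition_t_le dec; rewrite mulnS; lia.
- move=> i; have [? ? ?] := sizes_gt0 r_onto dec i.
  by split=> //; [apply: len_gt0 dec i | apply: sizes_sum dec i].
- have := sum_gap dec (fun i => layer_le r_edge r_onto degree_ge (i := i) order_le).
  move: (\sum_(j < t.+1) _) => S; nia.
- exact: (card_base r_lt dec x).
- by split=> //; apply: (embed_attaching r_edge r_lt degree_ge dec x).
Qed.

Local Open Scope ring_scope.

Theorem theorem4 (R : realType) (d : nat) (c : R) (hd : (0 < d)%N) :
  exists C : nat, forall (n : nat) (G : sgraph),
    connected G -> #|G| = n -> min_degree G = d ->
    `|(diam G)%:R - (3 * n)%:R / d.+1%:R| <= c ->
    in_family n d C G.
Proof.
(* Multiplied by [d.+1], the lower bound on the diameter loses at most [|c| * d.+1], which [K]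
   exceeds. The absolute value supplies the nonnegativity that [archi_boundP] asks for. *)
pose K := Num.bound (`|c| * d.+1%:R); exists ((3 * K + 2) * K.+1 + 1)%N => n G.
move=> conG <- mindeg; rewrite ler_norml => /andP [lower _].
apply: near_extremal_in_family => //; rewrite -(ler_nat R) natrD (natrM _ (diam G)).
have d_gt0 : 0 < d.+1%:R :> R by rewrite ltr0n.
have : (3 * #|G|)%:R / d.+1%:R <= (diam G)%:R + `|c|.
  by have := ler_norm c; move: lower; set q := _ / _; lra.
rewrite ler_pdivrMr // mulrDl => /le_trans -> //.
by rewrite lerD2l ltW // archi_boundP // mulr_ge0.
Qed.
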